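(* Let $V$ be a strictly convex real Banach space and let $(v,\alpha) \in V^{(\infty)}$. The spectral family of $(v,\alpha)$ is $\{e_\lambda(v,\alpha) : \lambda \in \mathbb{R}\}$, where $$e_\lambda(v,\alpha) = \begin{cases} 0, & \text{if } \lambda < \alpha - \|v\|,\\ \left(\frac{-v}{2\|v\|}, \frac12\right), & \text{if } \alpha - \|v\| \le \lambda < \alpha + \|v\|,\\ e, & \text{if } \alpha + \|v\| \le \lambda. \end{cases}$$
   Context: A normed linear space is strictly convex if the line segment joining any two points of its unit sphere does not meet the unit sphere except at its end points. $V^{(\infty)}$ denotes $V \times \mathbb{R}$ with coordinatewise operations, positive cone $V^{(\infty)+} = \{(v,\alpha) : \|v\| \le \alpha\}$ (so $x \le y$ iff $y - x \in V^{(\infty)+}$), order unit $e = (0,1)$, and norm $\|(v,\alpha)\|_\infty = \|v\| + |\alpha|$. The absolute value $|\cdot|$ is: $|(v,\alpha)| = (v,\alpha)$ if $(v,\alpha) \in V^{(\infty)+}$; $|(v,\alpha)| = -(v,\alpha)$ if $(v,\alpha) \in -V^{(\infty)+}$; $|(v,\alpha)| = \left(\frac{\alpha}{\|v\|}v, \|v\|\right)$ otherwise. Write $x \perp y$ if $|x-y| = x+y$. An order projection is an element $p$ with $0 \le p \le e$ and $p \perp e - p$; the set of order projections is denoted $OP(V^{(\infty)})$, and $p' := e - p$. For $p \in OP(V^{(\infty)})$ let $U_p = \{x \in V^{(\infty)} : |x| \le \lambda p \text{ for some } \lambda > 0\}$ and $AC(p) = U_p + U_{p'}$. For $x \in AC(p)$,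 write $x = C_p(x) + C_p'(x)$ with $C_p(x) \in U_p$ and $C_p'(x) \in U_{p'}$ (this decomposition is unique). The spectral family of $x \in V^{(\infty)}$ is the unique family $\{e_\lambda : \lambda \in \mathbb{R}\} \subset OP(V^{(\infty)})$ such that: (1) $\{e_\lambda\}$ is increasing in $\lambda$; (2) $e_\lambda = 0$ if $\lambda < -\|x\|_\infty$ and $e_\lambda = e$ if $\lambda \ge \|x\|_\infty$; (3) $x \in AC(e_\lambda)$ for all $\lambda \in \mathbb{R}$; (4) $C_{e_\lambda}(x) \le \lambda e_\lambda$ and $C_{e_\lambda}'(x) \ge \lambda e_\lambda'$ for each $\lambda \in \mathbb{R}$; (5) if $x \in AC(p)$ for some $p \in OP(V^{(\infty)})$ and $C_p(x) \le \lambda p$ and $C_p'(x) \ge \lambda p'$, then $p \le e_\lambda$; (6) $\bigwedge_{\lambda > \lambda_0} e_\lambda = e_{\lambda_0}$ for each $\lambda_0 \in \mathbb{R}$ (infimum in $OP(V^{(\infty)})$). *)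

(* Defs.v *)
From HB Require Import structures.
From mathcomp Require Import all_boot all_order all_algebra.
From mathcomp Require Import all_classical all_reals all_analysis.

Set Implicit Arguments.
Unset Strict Implicit.
Unset Printing Implicit Defensive.

Import Order.TTheory GRing.Theory Num.Theory.
Import numFieldNormedType.Exports.

Local Open Scope classical_set_scope.
Local Open Scope ring_scope.

Definition strictly_convex (R : realType) (V : normedModType R) : Prop :=
  forall (x y : V) (t : R), `|x| = 1 -> `|y| = 1 -> 0 <= t <= 1 ->
    let z := (1 - t) *: x + t *: y in
    `|z| = 1 -> z = x \/ z = y.

(* R^o makes the product a module over R.  The library's own norm on the
   product is the maximum norm; the norm ||.||_oo meant here is vnorm below. *)
Definition Vinf (R : realType) (V : normedModType R) : Type := (V * R^o)%type.

Section Vinf_theory.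
Context (R : realType) (V : normedModType R).
Implicit Types (x y z p q : Vinf V) (l : R).

Definition vcone x : bool := `|x.1| <= x.2.

Definition vle x y : bool := vcone (y - x).

Definition vunit : Vinf V := (0, 1).

Definition vnorm x : R := `|x.1| + `|x.2|.

Definition vabs x : Vinf V :=
  if vcone x then x
  else if vcone (- x) then - x
  else ((x.2 / `|x.1|) *: x.1, `|x.1|).

Definition vperp x y : Prop := vabs (x - y) = x + y.

Definition vcompl p : Vinf V := vunit - p.

Definition order_projection : set (Vinf V) :=
  [set p | [/\ vle 0 p, vle p vunit & vperp p (vcompl p)]].

Definition Uset p : set (Vinf V) :=
  [set x | exists l, 0 < l /\ vle (vabs x) (l *: p)].

Definition AC_decomposition p x : set (Vinf V * Vinf V) :=
  [set yz | [/\ Uset p yz.1, Uset (vcompl p) yz.2 & x = yz.1 + yz.2]].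

Definition AC p : set (Vinf V) :=
  [set x | exists yz, AC_decomposition p x yz].

(* The two components of the decomposition of x; they are meaningful only for
   x in AC p, and are 0 otherwise. *)
Definition Cproj p x : Vinf V := (xget (0, 0) (AC_decomposition p x)).1.

Definition Cproj' p x : Vinf V := (xget (0, 0) (AC_decomposition p x)).2.

Definition OP_infimum (S : set (Vinf V)) q : Prop :=
  [/\ order_projection q,
      forall p, S p -> vle q p &
      forall r, order_projection r -> (forall p, S p -> vle r p) -> vle r q].

Record is_spectral_family x (E : R -> Vinf V) : Prop := IsSpectralFamily {
  spectral_OP : forall l, order_projection (E l);
  spectral_increasing : forall l m, l <= m -> vle (E l) (E m);
  spectral_below : forall l, l < - vnorm x -> E l = 0;
  spectral_above : forall l, vnorm x <= l -> E l = vunit;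
  spectral_AC : forall l, AC (E l) x;
  spectral_le : forall l, vle (Cproj (E l) x) (l *: E l);
  spectral_ge : forall l, vle (l *: vcompl (E l)) (Cproj' (E l) x);
  spectral_greatest : forall l p, order_projection p -> AC p x ->
    vle (Cproj p x) (l *: p) -> vle (l *: vcompl p) (Cproj' p x) ->
    vle p (E l);
  spectral_right_continuous : forall l0,
    OP_infimum [set E l | l in [set l | l0 < l]] (E l0)
}.

Definition spectral_formula (v : V) (alpha : R) (l : R) : Vinf V :=
  if l < alpha - `|v| then 0
  else if l < alpha + `|v| then ((2 * `|v|)^-1 *: - v, 2^-1)
  else vunit.

End Vinf_theory.

Arguments vunit {R V}.

(* Main.v *)
Require Import Defs.
From HB Require Import structures.
From mathcomp Require Import all_boot all_order all_algebra.
From mathcomp Require Import all_classical all_reals all_analysis.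
From mathcomp Require Import ring lra.

Set Implicit Arguments.
Unset Strict Implicit.
Unset Printing Implicit Defensive.

Import Order.TTheory GRing.Theory Num.Theory.
Import numFieldNormedType.Exports.

Local Open Scope classical_set_scope.
Local Open Scope ring_scope.

(** The order projections are 0, e and the elements (w/2, 1/2) with w a unit
    vector, here called atoms.  Strict convexity says that the ray through a
    unit vector w is cut out by the equality case of the triangle inequality,
    and this makes the order interval between 0 and a multiple of an atom
    one-dimensional ([le_atom_ray]).  Hence U_p is the line through p when p is
    the atom of w, U_p' is the line through the atom of -w, and AC(p) is the
    plane of the pairs (s w, b), with the decomposition
      (s w, b) = (b + s) (w/2, 1/2) + (b - s) (-w/2, 1/2).

    Say that p cuts x at l when x is in AC(p), C_p(x) <= l p and
    C_p'(x) >= l p'.  For x = (v, alpha), the above shows that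
    - 0 cuts x at l iff l <= alpha - |v| ([cut0P]);
    - e cuts x at l iff alpha + |v| <= l ([cut1P]);
    - the atom of w cuts x at l iff v = - |v| w and
      alpha - |v| <= l <= alpha + |v| ([cut_atomP]).
    Therefore the value at l of the stated formula cuts x at l, and it is the
    largest order projection that does.  The formula is a step function of l
    that is constant to the right of each point, which gives the infimum
    property.  Uniqueness is formal: two spectral families of x both select, at
    each l, the greatest order projection cutting x at l, and the order is
    antisymmetric. *)

Section Spectral.
Context (R : realType) (V : normedModType R).
Implicit Types (x y z p q : Vinf V) (v w u : V) (a b c d l m s : R).

(** * The order and the absolute value *)

Lemma Vinf_eq x y : x.1 = y.1 -> x.2 = y.2 -> x = y.
Proof. by case: x => ? ?; case: y => ? ? /= -> ->. Qed.

Lemma vleE x y : vle x y = (`|y.1 - x.1| <= y.2 - x.2).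
Proof. by []. Qed.

Lemma vle_refl x : vle x x.
Proof. by rewrite vleE !subrr normr0. Qed.

Lemma vle_anti x y : vle x y -> vle y x -> x = y.
Proof.
rewrite !vleE => xy yx.
have n1 := normr_ge0 (y.1 - x.1); have n2 := normr_ge0 (x.1 - y.1).
apply: Vinf_eq; last by lra.
by apply/eqP; rewrite -subr_eq0 -normr_le0; lra.
Qed.

Lemma vcone_vabs x : vcone (vabs x).
Proof.
rewrite /vabs; case: ifPn => // nx; case: ifPn => //.
rewrite /vcone /= normrN => nnx; move: nx; rewrite /vcone => nx.
rewrite normrZ.
have [x0|x0] := eqVneq `|x.1| 0; first by rewrite x0 mulr0.
rewrite normrM normfV normr_id divfK //.
by rewrite ler_norml; apply/andP; split; lra.
Qed.

Lemma vabs_eq0 x : vabs x = 0 -> x = 0.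
Proof.
rewrite /vabs; case: ifPn => // nx; case: ifPn => nnx.
  by move=> /eqP; rewrite oppr_eq0 => /eqP.
case=> _ x0; exfalso; move: nx nnx; rewrite /vcone /= normrN x0; lra.
Qed.

(** * Order projections *)

Definition atom w : Vinf V := (2^-1 *: w, 2^-1).

Lemma vcompl0 : vcompl (0 : Vinf V) = vunit.
Proof. by rewrite /vcompl subr0. Qed.

Lemma vcompl1 : vcompl (vunit : Vinf V) = 0.
Proof. by rewrite /vcompl subrr. Qed.

Lemma vcompl_atom w : vcompl (atom w) = atom (- w).
Proof. by apply: Vinf_eq => /=; [rewrite sub0r scalerN | lra]. Qed.

(** The difference p - p' is 2p - e, and its absolute value is e only if it is
    e, -e or (w, 0) with |w| = 1. *)
Lemma order_projection_cases p : order_projection p ->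
  [\/ p = 0, p = vunit | exists2 w, `|w| = 1 & p = atom w].
Proof.
case=> _ _; rewrite /vperp (_ : p + vcompl p = vunit); last first.
  by rewrite /vcompl addrC subrK.
have sE : p - vcompl p = (2 *: p.1, 2 * p.2 - 1).
  by apply: Vinf_eq => /=; [rewrite sub0r opprK scaler_nat | lra].
rewrite {}sE /vabs; case: ifPn => [_|c1].
  case=> /eqP; rewrite scaler_eq0 pnatr_eq0.
  by move=> /eqP p1 p2; apply: Or32; apply: Vinf_eq => //=; lra.
case: ifPn => [_|c2].
  case=> /eqP; rewrite oppr_eq0 scaler_eq0 pnatr_eq0.
  by move=> /eqP p1 p2; apply: Or31; apply: Vinf_eq => //=; lra.
case=> /eqP /= + w1; rewrite w1 divr1 scaler_eq0.
rewrite -[_ *: p.1 == 0]normr_eq0 w1 oner_eq0 orbF.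
move=> /eqP p2; apply: Or33; exists (2 *: p.1) => //.
by apply: Vinf_eq => /=; [rewrite scalerA mulVf ?scale1r //|]; lra.
Qed.

Lemma order_projection0 : order_projection (0 : Vinf V).
Proof.
split; rewrite ?vle_refl //.
  by rewrite vleE /= !subr0 normr0.
rewrite /vperp vcompl0 sub0r add0r /vabs /vcone opprK /= oppr0 normr0.
by rewrite ler01 oppr_ge0 ler10.
Qed.

Lemma order_projection1 : order_projection (vunit : Vinf V).
Proof.
split; rewrite ?vle_refl //.
  by rewrite vleE /= !subr0 normr0.
by rewrite /vperp vcompl1 subr0 addr0 /vabs /vcone /= normr0 ler01.
Qed.

Lemma norm_half w : `|w| = 1 -> `|2^-1 *: w| = 2^-1.
Proof. by move=> w1; rewrite normrZ w1 mulr1 ger0_norm. Qed.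

Lemma order_projection_atom w : `|w| = 1 -> order_projection (atom w).
Proof.
move=> w1; split.
- by rewrite vleE /= !subr0 norm_half.
- rewrite vleE /= sub0r normrN norm_half //; lra.
rewrite /vperp vcompl_atom.
have -> : atom w - atom (- w) = (w, 0).
  apply: Vinf_eq => /=; last by lra.
  by rewrite scalerN opprK -scalerDl -[RHS]scale1r; congr (_ *: _); lra.
rewrite /vabs /vcone /= normrN w1 oppr0 ler10 mul0r scale0r.
by apply: Vinf_eq => /=; [rewrite scalerN subrr | lra].
Qed.

Lemma vle_order_projection0 p : order_projection p -> vle 0 p.
Proof. by case. Qed.

Lemma vle_order_projection1 p : order_projection p -> vle p vunit.
Proof. by case. Qed.

(** * The ideals generated by order projections *)

(** The norms of u and m w - u add up to at most m = |m w|, so w is a convex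
    combination of the directions of u and m w - u; strict convexity leaves
    only the two end points, and either gives u the direction w. *)
Lemma strictly_convex_ray w u a m : strictly_convex V -> `|w| = 1 ->
  `|u| <= a -> `|m *: w - u| <= m - a -> u = a *: w.
Proof.
move=> hV w1 ua mua.
have u0 := normr_ge0 u; have mu0 := normr_ge0 (m *: w - u).
have mE : `|m *: w| = m by rewrite normrZ w1 mulr1 ger0_norm //; lra.
have := ler_normD (m *: w - u) u; rewrite subrK mE => tri.
have [a0|a0] := eqVneq a 0.
  by rewrite a0 scale0r; apply/eqP; rewrite -normr_le0; lra.
have [ma|ma] := eqVneq m a.
  by apply/eqP; rewrite -ma eq_sym -subr_eq0 -normr_le0; lra.
have ma0 : m - a != 0 by rewrite subr_eq0.
have m0 : m != 0 by lra.
have apos : 0 < a by lra.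
have mapos : 0 < m - a by lra.
have mpos : 0 < m by lra.
have t01 : 0 <= (m - a) / m <= 1.
  apply/andP; split; first by rewrite divr_ge0 // ltW.
  by rewrite ler_pdivrMr // mul1r; lra.
have := hV (a^-1 *: u) ((m - a)^-1 *: (m *: w - u)) ((m - a) / m).
have zE : (1 - (m - a) / m) *: (a^-1 *: u) +
    ((m - a) / m) *: ((m - a)^-1 *: (m *: w - u)) = w.
  rewrite !scalerA (_ : (1 - (m - a) / m) / a = m^-1); last first.
    by field; apply/andP.
  rewrite (_ : (m - a) / m / (m - a) = m^-1); last by field; apply/andP.
  by rewrite -scalerDr addrC subrK scalerA mulVf // scale1r.
rewrite /= zE => /(_ _ _ t01 w1) [].
- by rewrite normrZ gtr0_norm ?invr_gt0 // (_ : `|u| = a) ?mulVf //; lra.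
- rewrite normrZ gtr0_norm ?invr_gt0 // (_ : `|m *: w - u| = m - a).
    by rewrite mulVf.
  by lra.
- by move=> ->; rewrite scalerA mulfV // scale1r.
- move=> /(congr1 (fun t => (m - a) *: t)); rewrite scalerA mulfV // scale1r.
  by move=> E; rewrite -[u](subKr (m *: w)) -E -scalerBl subKr.
Qed.

Lemma le_atom_ray w y l : strictly_convex V -> `|w| = 1 ->
  vcone y -> vle y (l *: atom w) -> y = (2 * y.2) *: atom w.
Proof.
move=> hV w1 y0; rewrite vleE /= scalerA => yl.
apply: Vinf_eq => /=; last by rewrite /GRing.scale /=; field.
by rewrite scalerA mulrC mulKf // (strictly_convex_ray hV w1 y0 yl).
Qed.

Lemma Uset0 x : Uset 0 x -> x = 0.
Proof.
case=> l [_]; rewrite scaler0 => x0; apply: vabs_eq0; apply: vle_anti => //.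
by rewrite /vle subr0 vcone_vabs.
Qed.

Lemma Uset_zero p : order_projection p -> Uset p 0.
Proof.
case=> p0 _ _; exists 1; split=> //.
by rewrite /vabs /vcone /= normr0 lexx scale1r.
Qed.

Lemma Uset1 x : Uset vunit x.
Proof.
exists (1 + `|(vabs x).1| + `|(vabs x).2|); split.
  by rewrite -addrA ltr_wpDr // addr_ge0.
rewrite vleE /= scaler0 sub0r normrN /GRing.scale /=.
have := ler_norm (vabs x).2; lra.
Qed.

(** The absolute value of x lies on the ray of the atom by [le_atom_ray], and
    a pair outside the cone and its opposite has an absolute value interior to
    the cone, hence off that ray. *)
Lemma Uset_atom w x : strictly_convex V -> `|w| = 1 ->
  Uset (atom w) x -> exists c, x = c *: atom w.
Proof.
move=> hV w1 [l [l0 /(le_atom_ray hV w1 (vcone_vabs x))]].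
rewrite /vabs; case: ifPn => [_ ->|nx]; first by eexists.
case: ifPn => [_ /(congr1 -%R)|nnx].
  by rewrite opprK -scaleNr => ->; eexists.
move=> /(congr1 fst) /=; rewrite scalerA [_ * 2^-1]mulrC mulKf //.
move=> /(congr1 Num.norm); rewrite !normrZ w1 mulr1 normr_id.
move: nx nnx; rewrite /vcone /= normrN.
have [-> |x0] := eqVneq `|x.1| 0; first lra.
rewrite normfV normr_id divfK //.
by move=> n1 n2 E; exfalso; move: n1 n2; rewrite -E; case: (ger0P x.2); lra.
Qed.

Lemma Uset_scale_atom w c : `|w| = 1 -> Uset (atom w) (c *: atom w).
Proof.
move=> w1; have nE m : `|m *: (2^-1 *: w)| = `|m| / 2.
  by rewrite normrZ norm_half.
exists (`|c| + 1); split; first by rewrite ltr_wpDl.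
have -> : vabs (c *: atom w) = `|c| *: atom w.
  rewrite /vabs /vcone -scaleNr /= !nE normrN /GRing.scale /=.
  by case: (ger0P c) => c0; [rewrite ifT | rewrite ifF ?ifT] => //; lra.
rewrite vleE /= -scalerBl addrC addKr scale1r norm_half // /GRing.scale /=.
by lra.
Qed.

(** * Order projections that cut an element at a level *)

Lemma AC_decomposition_unique p x yz yz' : strictly_convex V ->
  order_projection p -> AC_decomposition p x yz -> AC_decomposition p x yz' ->
  yz = yz'.
Proof.
case: yz yz' => [y z] [y' z'] hV /order_projection_cases [->|->|[w w1 ->]].
- move=> [/= /Uset0 -> _ ->] [/= /Uset0 -> _]; by rewrite !add0r => ->.
- rewrite /AC_decomposition vcompl1.
  move=> [/= _ /Uset0 -> ->] [/= _ /Uset0 ->]; by rewrite !addr0 => ->.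
have w1' : `|- w| = 1 by rewrite normrN.
rewrite /AC_decomposition vcompl_atom.
move=> [/= /(Uset_atom hV w1) [c ->] /(Uset_atom hV w1') [d ->] ->].
move=> [/= /(Uset_atom hV w1) [c' ->] /(Uset_atom hV w1') [d' ->]] E.
have E2 := congr1 snd E; rewrite /= /GRing.scale /= in E2.
have := congr1 fst E => /=; rewrite !scalerN -!scalerBl => /eqP.
rewrite -subr_eq0 -scalerBl !scaler_eq0 -[w == 0]normr_eq0 w1 oner_eq0 orbF.
rewrite invr_eq0 pnatr_eq0 orbF.
by move: E E2 => _ E2 /eqP E1; congr (_ *: _, _ *: _); lra.
Qed.

Definition cut x l p :=
  [/\ Defs.AC p x, vle (Cproj p x) (l *: p) & vle (l *: vcompl p) (Cproj' p x)].

(** Since the decomposition is unique, the chosen components of x may be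
    replaced by those of any decomposition at hand. *)
Lemma cutP x l p : strictly_convex V -> order_projection p ->
  cut x l p <-> exists yz, [/\ AC_decomposition p x yz,
    vle yz.1 (l *: p) & vle (l *: vcompl p) yz.2].
Proof.
move=> hV pP.
have xgetE yz : AC_decomposition p x yz ->
    xget (0, 0) (AC_decomposition p x) = yz.
  move=> h; apply: (AC_decomposition_unique hV pP _ h).
  by apply: xgetPex; exists yz.
split=> [[[yz h]]|[yz [h]]].
  by rewrite /Cproj /Cproj' (xgetE _ h); exists yz.
by rewrite /cut /Cproj /Cproj' (xgetE _ h); split=> //; exists yz.
Qed.

Lemma cut0P x l : strictly_convex V -> cut x l 0 <-> l <= x.2 - `|x.1|.
Proof.
move=> hV; rewrite (cutP _ _ hV order_projection0).
have xE : vle (l *: vcompl 0) x = (l <= x.2 - `|x.1|).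
  rewrite vcompl0 vleE /= scaler0 subr0 /GRing.scale /= mulr1.
  by apply/idP/idP; lra.
split=> [[[y z] [[/= /Uset0 -> _ xyz] _ ?]]|xl].
  by rewrite -xE xyz add0r.
exists (0, x); rewrite xE scaler0 vle_refl; split=> //.
split=> /=; rewrite ?add0r //; first exact/Uset_zero/order_projection0.
by rewrite vcompl0; apply: Uset1.
Qed.

Lemma cut1P x l : strictly_convex V -> cut x l vunit <-> x.2 + `|x.1| <= l.
Proof.
move=> hV; rewrite (cutP _ _ hV order_projection1).
have xE : vle x (l *: vunit) = (x.2 + `|x.1| <= l).
  rewrite vleE /= scaler0 sub0r normrN /GRing.scale /= mulr1.
  by apply/idP/idP; lra.
rewrite vcompl1 scaler0.
split=> [[[y z] [[/= _ + xyz] yl _]]|xl].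
  by rewrite vcompl1 => /Uset0 z0; rewrite -xE xyz z0 addr0.
exists (x, 0); rewrite xE vle_refl; split=> //.
split=> /=; rewrite ?addr0 //; first exact: Uset1.
by rewrite vcompl1; apply/Uset_zero/order_projection0.
Qed.

Lemma vle_scale_atom w c d : `|w| = 1 ->
  vle (c *: atom w) (d *: atom w) = (c <= d).
Proof.
move=> w1; rewrite vleE /= -scalerBl normrZ norm_half // /GRing.scale /=.
by apply/idP/idP; case: (ger0P (d - c)); lra.
Qed.

(** Writing x = c p + d p', the condition is c <= l <= d, while the vector part
    of x is ((c - d) / 2) w; the sign of c - d fixes this coefficient to be
    - |x.1|. *)
Lemma cut_atomP x l w : strictly_convex V -> `|w| = 1 ->
  cut x l (atom w) <->
    x.1 = - `|x.1| *: w /\ x.2 - `|x.1| <= l <= x.2 + `|x.1|.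
Proof.
move=> hV w1; rewrite (cutP _ _ hV (order_projection_atom w1)).
have w1' : `|- w| = 1 by rewrite normrN.
rewrite /AC_decomposition vcompl_atom; split.
- case=> -[y z] [[/= /(Uset_atom hV w1) [c ->] /(Uset_atom hV w1') [d ->] ->]].
  rewrite !vle_scale_atom // => cl ld.
  have E : (c *: (2^-1 *: w) + d *: (2^-1 *: - w)) = ((c - d) / 2) *: w.
    by rewrite !scalerN !scalerA -scalerBl; congr (_ *: _); lra.
  rewrite /= E normrZ w1 mulr1 ler0_norm; last by lra.
  by rewrite opprK /GRing.scale /=; split=> //; lra.
- move=> [xw /andP[l1 l2]].
  exists ((x.2 - `|x.1|) *: atom w, (x.2 + `|x.1|) *: atom (- w)).
  rewrite /= !vle_scale_atom //; split=> //.
  split; rewrite /=; [exact: Uset_scale_atom..|].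
  apply: Vinf_eq => /=; last by rewrite /GRing.scale /=; lra.
  rewrite {1}xw !scalerN !scalerA -scalerBl; congr (_ *: _); lra.
Qed.

Definition greatest_cut x l p :=
  [/\ order_projection p, cut x l p &
      forall q, order_projection q -> cut x l q -> vle q p].

Lemma greatest_cut_unique x l p q :
  greatest_cut x l p -> greatest_cut x l q -> p = q.
Proof.
by move=> [pO pc pg] [qO qc qg]; apply: vle_anti; [apply: qg|apply: pg].
Qed.

Lemma spectral_greatest_cut x (E : R -> Vinf V) l :
  is_spectral_family x E -> greatest_cut x l (E l).
Proof.
case=> EO _ _ _ EA El Eg Em _; split=> // q qO [qA ql qg].
exact: Em.
Qed.

(** * The spectral formula *)

(** The middle case forces v to be nonzero, and w is then - v / |v|; only the
    relation between v and w is recorded, which is the form of [cut_atomP]. *)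
Variant spectral_formula_spec v a l : Vinf V -> Prop :=
| SpectralLow of l < a - `|v| : spectral_formula_spec v a l 0
| SpectralMid w of `|w| = 1 & v = - `|v| *: w & a - `|v| <= l < a + `|v| :
    spectral_formula_spec v a l (atom w)
| SpectralHigh of a + `|v| <= l : spectral_formula_spec v a l vunit.

Lemma spectral_formulaP v a l :
  spectral_formula_spec v a l (spectral_formula v a l).
Proof.
rewrite /spectral_formula.
case: ltP => [?|la]; first exact: SpectralLow.
case: ltP => [al|?]; last exact: SpectralHigh.
have v0 : `|v| != 0 by lra.
have -> : ((2 * `|v|)^-1 *: - v, 2^-1) = atom (`|v|^-1 *: - v).
  by apply: Vinf_eq => //=; rewrite scalerA invfM.
apply: SpectralMid; last by rewrite la al.
  by rewrite normrZ normrN normfV normr_id mulVf.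
by rewrite scalerN scaleNr scalerN opprK scalerA mulfV // scale1r.
Qed.

Lemma order_projection_spectral_formula v a l :
  order_projection (spectral_formula v a l).
Proof.
case: spectral_formulaP => *; first exact: order_projection0.
  exact: order_projection_atom.
exact: order_projection1.
Qed.

(** If v is nonzero, at most one atom cuts (v, a), because v = - |v| w
    determines w.  If v = 0, every atom cuts (0, a) at the level a, but the
    formula takes the value e there, which lies above all of them. *)
Lemma spectral_formula_greatest_cut v a l : strictly_convex V ->
  greatest_cut (v, a) l (spectral_formula v a l).
Proof.
move=> hV; have v0 := normr_ge0 v.
case: spectral_formulaP => [la|w w1 vw /andP[la al]|al]; split.
- exact: order_projection0.
- by apply/cut0P => //=; lra.
- move=> q /order_projection_cases [->|->|[w w1 ->]].
  + by move=> _; apply: vle_refl.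
  + by move=> /cut1P /= -/(_ hV); lra.
  + by move=> /cut_atomP /= -/(_ hV w1) []; lra.
- exact: order_projection_atom.
- by apply/cut_atomP => //=; split=> //; lra.
- move=> q /order_projection_cases [->|->|[w' w1' ->]].
  + by move=> _; apply/vle_order_projection0/order_projection_atom.
  + by move=> /cut1P /= -/(_ hV); lra.
  move=> /cut_atomP /= -/(_ hV w1') [vw' _].
  suff -> : w' = w by apply: vle_refl.
  have nv0 : - `|v| != 0 by lra.
  by apply: (scalerI nv0); rewrite -vw' -vw.
- exact: order_projection1.
- by apply/cut1P => //=; lra.
- by move=> q qO _; apply: vle_order_projection1.
Qed.

Lemma spectral_formula_increasing v a l m : l <= m ->
  vle (spectral_formula v a l) (spectral_formula v a m).
Proof.
move=> lm; move: (order_projection_spectral_formula v a l).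
move: (order_projection_spectral_formula v a m).
rewrite /spectral_formula; have v0 := normr_ge0 v.
case: (ltP l (a - _)) => [_ mO _|la]; first exact: vle_order_projection0.
case: (ltP m (a - _)) => [|_]; first lra.
case: (ltP m) => [ma|_ _ lO]; last exact: vle_order_projection1.
by case: (ltP l) => [_ _ _|]; [apply: vle_refl|lra].
Qed.

Lemma spectral_formula_right_constant v a l :
  exists2 m, l < m & spectral_formula v a m = spectral_formula v a l.
Proof.
have v0 := normr_ge0 v; rewrite /spectral_formula.
case: (ltP l) => [la|la].
  by exists ((l + (a - `|v|)) / 2); [|rewrite ifT //]; lra.
case: (ltP l) => [al|al].
  by exists ((l + (a + `|v|)) / 2); [|rewrite ifF ?ifT //]; lra.
by exists (l + 1); [|rewrite !ifF //]; lra.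
Qed.

Lemma spectral_formula_is_spectral_family v a : strictly_convex V ->
  is_spectral_family (v, a) (spectral_formula v a).
Proof.
move=> hV; have gc l := spectral_formula_greatest_cut v a l hV.
have v0 := normr_ge0 v; have la := ler_norm a; have na := ler_norm (- a).
rewrite normrN in na.
split.
- exact: order_projection_spectral_formula.
- by move=> l m; apply: spectral_formula_increasing.
- by move=> l; rewrite /vnorm /= => lx; rewrite /spectral_formula ifT //; lra.
- move=> l; rewrite /vnorm /= => lx; rewrite /spectral_formula !ifF //; lra.
- by move=> l; case: (gc l) => _ [].
- by move=> l; case: (gc l) => _ [].
- by move=> l; case: (gc l) => _ [].
- by move=> l p pO pA pl pg; case: (gc l) => _ _; apply.
move=> l; split; first exact: order_projection_spectral_formula.
  by move=> _ [m /= /ltW lm <-]; apply: spectral_formula_increasing.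
move=> r _ rE; have [m lm <-] := spectral_formula_right_constant v a l.
by apply: rE; exists m.
Qed.

End Spectral.

Theorem proposition3p4 (R : realType) (V : completeNormedModType R)
    (hV : strictly_convex V) (v : V) (alpha : R) :
  is_spectral_family ((v, alpha) : Vinf V) (spectral_formula v alpha) /\
  (forall E : R -> Vinf V,
     is_spectral_family ((v, alpha) : Vinf V) E ->
     forall l : R, E l = spectral_formula v alpha l).
Proof.
split=> [|E Es l]; first exact: spectral_formula_is_spectral_family.
apply: (greatest_cut_unique (spectral_greatest_cut l Es)).
exact: spectral_formula_greatest_cut.
Qed.
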